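(* Let $(N,\nu)$ be a Markowitz portfolio game, i.e. for each coalition $S\subseteq N$, $$\nu(S)=\max\Big\{\langle\mu,x\rangle:\ \sum_{j=1}^mx_j=c(S),\ x^\top Qx\le R(S)^2,\ x\ge0\Big\},$$ and suppose that for all coalitions $S,T\subseteq N$ with $|S|\le|T|$ one has $\frac{R(T)}{|T|}\ge\frac{R(S)}{|S|}$. Consider the second-order cone program for coalition $S$ $$\nu(S)=\max\ \langle\mu,x\rangle\quad\text{s.t.}\quad e^\top x=c(S),\quad -y+Lx=0,\quad s=R(S),\quad (y,s;x)\in\mathcal{L}^m\times\mathbb{R}^m_+,$$ where $Q=L^\top L$. If this conic program for the grand coalition $S=N$ verifies the Slater condition, then the core of $(N,\nu)$ is nonempty.
   Context: $N$ is a finite set of agents; agent $i$ owns capital $c_i$ and $c(S)=\sum_{i\in S}c_i$; there are $m$ assets with expected returns $\mu\in\mathbb{R}^m$; $Q\in\mathbb{R}^{m\times m}$ is a positive definite covariance matrix, with Cholesky factorization $Q=L^\top L$, $L$ triangular; $R(S)\ge0$ is the admissible risk threshold of coalition $S$. $e$ is the all-ones vector and $\mathcal{L}^m=\{(y,s)\in\mathbb{R}^m\times\mathbb{R}:s\ge\|y\|_2\}$. Coalitions in the condition on $R$ are nonempty. ''max'' denotes the optimal value; since $(N,\nu)$ is a TU game, $\nu$ is real-valued. The Slater condition for the program means that there is a feasible point in the interior of the cone, i.e. a feasible $(y,s,x)$ with $(y,s)$ in the interior of $\mathcal{L}^m$ and $x>0$ componentwise. The core of a TU game $(N,\nu)$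 is the set of $z\in\mathbb{R}^N$ with $\sum_{i\in N}z_i=\nu(N)$ and $\sum_{i\in S}z_i\ge\nu(S)$ for all coalitions $\emptyset\ne S\subset N$. *)

(* Defs.v *)
From mathcomp Require Import all_boot all_order all_algebra.
From mathcomp Require Import classical_sets reals topology normedtype.

Set Implicit Arguments.
Unset Strict Implicit.
Unset Printing Implicit Defensive.

Import Order.TTheory GRing.Theory Num.Theory.
Import numFieldNormedType.Exports.

Local Open Scope ring_scope.

Definition dotv (R : realType) (m : nat) (u v : 'cV[R]_m) : R :=
  \sum_(j < m) u j 0 * v j 0.

(* The library's norm on column vectors is the sup norm, so the Euclidean norm
   is defined here. *)
Definition norm2 (R : realType) (m : nat) (y : 'cV[R]_m) : R :=
  Num.sqrt (\sum_(j < m) y j 0 ^+ 2).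

Definition quadf (R : realType) (m : nat) (Q : 'M[R]_m) (x : 'cV[R]_m) : R :=
  (x^T *m Q *m x) 0 0.

Definition posdefmx (R : realType) (m : nat) (Q : 'M[R]_m) : Prop :=
  Q^T = Q /\ forall x : 'cV[R]_m, x != 0 -> 0 < quadf Q x.

(* [is_trig_mx] means lower triangular; either orientation is accepted. *)
Definition cholesky (R : realType) (m : nat) (Q L : 'M[R]_m) : Prop :=
  (is_trig_mx L || is_trig_mx L^T) /\ Q = L^T *m L.

Definition lorentz_cone (R : realType) (m : nat) : set ('cV[R]_m * R) :=
  [set ys : 'cV[R]_m * R | norm2 ys.1 <= ys.2]%classic.

Definition coalition_capital (R : realType) (N : finType) (c : N -> R)
    (S : {set N}) : R :=
  \sum_(i in S) c i.

(* The maximum of [f] over [A] exists (is attained) and equals [v]. *)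
Definition is_max_value (R : realType) (T : Type) (A : set T) (f : T -> R)
    (v : R) : Prop :=
  (f @` A)%classic v /\ ubound (f @` A)%classic v.

Definition markowitz_feasible (R : realType) (N : finType) (m : nat)
    (c : N -> R) (Q : 'M[R]_m) (risk : {set N} -> R) (S : {set N}) :
    set 'cV[R]_m :=
  [set x : 'cV[R]_m | [/\ \sum_(j < m) x j 0 = coalition_capital c S,
               quadf Q x <= risk S ^+ 2
             & forall j, 0 <= x j 0]]%classic.

(* That [nu] is real-valued makes feasibility of the program of every coalition
   part of this definition. *)
Definition markowitz_game (R : realType) (N : finType) (m : nat)
    (c : N -> R) (mu : 'cV[R]_m) (Q : 'M[R]_m) (risk : {set N} -> R)
    (nu : {set N} -> R) : Prop :=
  forall S : {set N},
    is_max_value (markowitz_feasible c Q risk S) (dotv mu) (nu S).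

(* The variables are triples [(y, s, x)]. *)
Definition conic_feasible (R : realType) (N : finType) (m : nat)
    (c : N -> R) (L : 'M[R]_m) (risk : {set N} -> R) (S : {set N}) :
    set ('cV[R]_m * R * 'cV[R]_m) :=
  [set ysx : 'cV[R]_m * R * 'cV[R]_m | let: (y, s, x) := ysx in
     [/\ dotv (const_mx 1) x = coalition_capital c S,
         - y + L *m x = 0,
         s = risk S,
         @lorentz_cone R m (y, s)
       & forall j, 0 <= x j 0]]%classic.

Definition slater (R : realType) (N : finType) (m : nat)
    (c : N -> R) (L : 'M[R]_m) (risk : {set N} -> R) (S : {set N}) : Prop :=
  exists (y : 'cV[R]_m) (s : R) (x : 'cV[R]_m),
    [/\ conic_feasible c L risk S (y, s, x),
        interior (@lorentz_cone R m) (y, s)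
      & forall j, 0 < x j 0].

Definition core (R : realType) (N : finType) (nu : {set N} -> R) :
    set (N -> R) :=
  [set z : N -> R | \sum_(i : N) z i = nu [set: N]%SET /\
           forall S : {set N}, S != finset.set0 ->
             nu S <= \sum_(i in S) z i]%classic.

Lemma conic_feasible_proj (R : realType) (N : finType) (m : nat)
    (c : N -> R) (Q L : 'M[R]_m) (risk : {set N} -> R) (S : {set N})
    (x : 'cV[R]_m) :
  Q = L^T *m L -> 0 <= risk S ->
  markowitz_feasible c Q risk S x <->
  exists y s, conic_feasible c L risk S (y, s, x).
Proof.
move=> -> r0.
have qE : quadf (L^T *m L) x = \sum_(j < m) (L *m x) j 0 ^+ 2.
  rewrite /quadf mulmxA -trmx_mul -mulmxA mxE.
  by apply: eq_bigr => j _; rewrite mxE expr2.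
have eE : dotv (const_mx 1) x = \sum_(j < m) x j 0.
  by apply: eq_bigr => j _; rewrite mxE mul1r.
have nE : (norm2 (L *m x) <= risk S) = (quadf (L^T *m L) x <= risk S ^+ 2).
  rewrite /norm2 -qE -[in RHS]ler_sqrt ?exprn_ge0//.
  by rewrite sqrtr_sqr ger0_norm.
split=> [[h1 h2 h3]|[y [s [h1 h2 h3 h4 h5]]]].
  exists (L *m x), (risk S); split; rewrite ?eE ?addNr//.
  by have := h2; rewrite -nE.
have yE : y = L *m x by move/eqP: h2; rewrite addrC subr_eq0 => /eqP <-.
split=> //; first by rewrite -eE.
by rewrite -nE -yE -h3; exact: h4.
Qed.

(* The conic program, with objective <mu, x>, is a reformulation of the
   program defining the game: it has the same optimal value. *)
Lemma conic_max_value (R : realType) (N : finType) (m : nat)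
    (c : N -> R) (mu : 'cV[R]_m) (Q L : 'M[R]_m) (risk : {set N} -> R)
    (S : {set N}) (v : R) :
  Q = L^T *m L -> 0 <= risk S ->
  is_max_value (markowitz_feasible c Q risk S) (dotv mu) v <->
  is_max_value (conic_feasible c L risk S) (fun ysx => dotv mu ysx.2) v.
Proof.
move=> QE r0; have P x := conic_feasible_proj c x QE r0.
split=> -[[w fw <-] ub]; split.
- by have /P[y [s h]] := fw; exists (y, s, w).
- move=> _ [[[y s] x] h <-]; apply: ub; exists x => //.
  by apply/P; exists y, s.
- by case: w fw {ub} => -[y s] x h; exists x => //; apply/P; exists y, s.
- move=> _ [x /P[y [s h]] <-]; apply: ub; by exists (y, s, x).
Qed.

(* Main.v *)
Require Import Defs.
From mathcomp Require Import all_boot all_order all_algebra.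
From mathcomp Require Import classical_sets reals topology normedtype.
From mathcomp Require Import lra ring.

Set Implicit Arguments.
Unset Strict Implicit.
Unset Printing Implicit Defensive.

Import Order.TTheory GRing.Theory Num.Theory.
Import numFieldNormedType.Exports.

Local Open Scope ring_scope.

(** The core allocation is read off from optimal dual multipliers of the program
    of the grand coalition.  Suppose that some [lam] and [kap >= 0] satisfy
    [<mu, x> <= lam * (e^T x) + kap * |L x|] for every [x >= 0], together with
    [nu(N) = lam * c(N) + kap * R(N)].  Evaluating the inequality at an optimal
    portfolio of a coalition S gives [nu(S) <= lam * c(S) + kap * R(S)], and the
    hypothesis on the per capita risk bounds R(S) by |S| R(N) / |N|.  Paying
    agent i the amount [lam * c_i + kap * R(N) / |N|] is therefore a core
    allocation ([core_of_multipliers]).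

    The multipliers are obtained in [conic_multipliers].  On the slice
    [e^T x = c(N), x >= 0], the grand coalition maximizes an affine function
    under the single convex constraint [|L x| <= R(N)], which holds strictly
    somewhere by the Slater condition.  A multiplier for one constraint is a
    real number separating two sets of ratios, so the completeness of the reals
    suffices to find it ([one_constraint_multiplier]).  Homogeneity then extends
    the inequality from the slice to the whole orthant; this uses c(N) > 0,
    which the componentwise positive Slater point provides as soon as there is
    at least one asset.  Without assets the game is zero. *)

(** Lagrange multiplier for the maximization of a concave [f] over a convex set
    [D] under one convex constraint [g <= 0] with a Slater point [b], when the
    optimal value is at most 0.  The required inequality says that [kap] is at
    least [f x / g x] where [g x > 0] and at most [f y / g y] where [g y < 0];
    convexity puts the ratios of the first kind below those of the second, and
    [kap] is the supremum of 0 and of the former. *)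
Lemma one_constraint_multiplier (R : realType) (V : lmodType R) (D : set V)
    (f g : V -> R) (b : V) :
  (forall x y t, D x -> D y -> 0 <= t <= 1 ->
     [/\ D (t *: x + (1 - t) *: y),
         t * f x + (1 - t) * f y <= f (t *: x + (1 - t) *: y)
       & g (t *: x + (1 - t) *: y) <= t * g x + (1 - t) * g y]) ->
  D b -> g b < 0 ->
  (forall x, D x -> g x <= 0 -> f x <= 0) ->
  exists2 kap, 0 <= kap & forall x, D x -> f x <= kap * g x.
Proof.
move=> cvx Db gb0 opt.
pose E : set R := fun k => k = 0 \/ exists x, [/\ D x, 0 < g x & k = f x / g x].
have E0 : E 0 by left.
have Eub y : D y -> g y < 0 -> ubound E (f y / g y).
  move=> Dy gy0 _ [->|[x [Dx gx0 ->]]].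
    by rewrite -mulrNN -invrN divr_ge0 ?oppr_ge0 ?opt ?ltW.
  (* The convex combination of x and y at which the convexity bound on g is 0. *)
  pose t := - g y / (g x - g y).
  have d0 : 0 < g x - g y by lra.
  have t01 : 0 <= t <= 1.
    by rewrite divr_ge0 ?ler_pdivrMr//; lra.
  have [Dz fz gz] := cvx x y t Dx Dy t01.
  have tE : 1 - t = g x / (g x - g y) by rewrite /t; field; rewrite gt_eqF.
  have gz0 : g (t *: x + (1 - t) *: y) <= 0.
    apply: (le_trans gz); rewrite tE /t le_eqVlt; apply/orP; left; apply/eqP.
    by field; rewrite gt_eqF.
  have := le_trans fz (opt _ Dz gz0).
  rewrite tE /t mulrAC [X in _ + X]mulrAC -mulrDl pmulr_lle0 ?invr_gt0// => H.
  rewrite ler_pdivrMr// mulrAC -mulrNN -invrN -[X in X / _]mulNr.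
  by rewrite ler_pdivlMr; lra.
have hE : has_ubound E by exists (f b / g b); exact: Eub.
exists (sup E); first exact: ub_le_sup.
move=> x Dx; have [gx|gx|gx] := ltgtP (g x) 0.
- rewrite -ler_ndivlMr//; apply: ge_sup; first by exists 0.
  exact: Eub.
- rewrite -ler_pdivrMr//; apply: ub_le_sup => //.
  by right; exists x.
- by rewrite gx mulr0 opt// gx.
Qed.

Lemma norm2_ge0 (R : realType) (m : nat) (y : 'cV[R]_m) : 0 <= norm2 y.
Proof. exact: sqrtr_ge0. Qed.

Lemma sqr_norm2 (R : realType) (m : nat) (y : 'cV[R]_m) :
  norm2 y ^+ 2 = dotv y y.
Proof.
rewrite sqr_sqrtr; last by apply: sumr_ge0 => j _; rewrite sqr_ge0.
by apply: eq_bigr => j _; rewrite expr2.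
Qed.

Lemma dotvC (R : realType) (m : nat) (u v : 'cV[R]_m) : dotv u v = dotv v u.
Proof. by apply: eq_bigr => j _; rewrite mulrC. Qed.

Lemma dotvDr (R : realType) (m : nat) (u v w : 'cV[R]_m) :
  dotv u (v + w) = dotv u v + dotv u w.
Proof. by rewrite -big_split; apply: eq_bigr => j _; rewrite mxE mulrDr. Qed.

Lemma dotvZr (R : realType) (m : nat) (u v : 'cV[R]_m) (a : R) :
  dotv u (a *: v) = a * dotv u v.
Proof. by rewrite mulr_sumr; apply: eq_bigr => j _; rewrite mxE mulrCA. Qed.

Lemma norm2Z (R : realType) (m : nat) (a : R) (y : 'cV[R]_m) :
  0 <= a -> norm2 (a *: y) = a * norm2 y.
Proof.
move=> a0; apply/eqP; rewrite -(@eqrXn2 _ 2) ?mulr_ge0 ?norm2_ge0//.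
by rewrite exprMn !sqr_norm2 dotvZr dotvC dotvZr; apply/eqP; ring.
Qed.

Lemma norm2_eq0 (R : realType) (m : nat) (y : 'cV[R]_m) :
  norm2 y = 0 -> y = 0.
Proof.
move=> y0; have /eqP := sqr_norm2 y; rewrite y0 expr0n /= eq_sym psumr_eq0.
  move=> /allP yj0; apply/colP => j; rewrite mxE; apply/eqP.
  by have := yj0 j (mem_index_enum _); rewrite /= mulf_eq0 orbb.
by move=> j _; rewrite -expr2 sqr_ge0.
Qed.

Lemma dotv0 (R : realType) (m : nat) (u : 'cV[R]_m) : dotv u 0 = 0.
Proof. by rewrite /dotv big1// => j _; rewrite mxE mulr0. Qed.

Lemma norm20 (R : realType) (m : nat) : norm2 (0 : 'cV[R]_m) = 0.
Proof. by apply/eqP; rewrite -sqrf_eq0 sqr_norm2 dotv0. Qed.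

(** Cauchy-Schwarz. *)
Lemma dotv_le_norm2 (R : realType) (m : nat) (u v : 'cV[R]_m) :
  dotv u v <= norm2 u * norm2 v.
Proof.
have [/norm2_eq0 ->|u0] := eqVneq (norm2 u) 0.
  by rewrite dotvC dotv0 norm20 mul0r.
have [/norm2_eq0 ->|v0] := eqVneq (norm2 v) 0.
  by rewrite dotv0 norm20 mulr0.
have uv_gt0 : 0 < norm2 u * norm2 v.
  by rewrite mulr_gt0// lt_def ?u0 ?v0 norm2_ge0.
rewrite -subr_ge0 -(pmulr_lge0 _ uv_gt0) -(@pmulr_rge0 _ 2)//.
(* Expand the squared norm of |v| u - |u| v. *)
have := sqr_ge0 (norm2 (norm2 v *: u + (- norm2 u) *: v)).
rewrite sqr_norm2 dotvDr !dotvZr ![dotv (_ + _) _]dotvC !dotvDr !dotvZr.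
rewrite (dotvC v u) -!sqr_norm2; congr (_ <= _); ring.
Qed.

Lemma norm2_triangle (R : realType) (m : nat) (u v : 'cV[R]_m) :
  norm2 (u + v) <= norm2 u + norm2 v.
Proof.
rewrite -ler_sqr ?nnegrE ?addr_ge0 ?norm2_ge0//.
rewrite sqr_norm2 dotvDr ![dotv (_ + _) _]dotvC !dotvDr (dotvC v u).
by rewrite -!sqr_norm2; have := dotv_le_norm2 u v; lra.
Qed.

Lemma sum_col0 (R : realType) (m : nat) (x : 'cV[R]_m) :
  (forall j, 0 <= x j 0) -> \sum_(j < m) x j 0 = 0 -> x = 0.
Proof.
move=> x0 /eqP; rewrite psumr_eq0; last by move=> j _; exact: x0.
move=> /allP xj0; apply/colP => j; rewrite mxE; apply/eqP.
exact: (xj0 j (mem_index_enum _)).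
Qed.

(** Strong duality for the maximization of [<mu, x>] over the points [x >= 0] of
    total [C] with [|L x| <= r], in the presence of a Slater point [b] (only the
    norm constraint needs to be strict): any upper bound [v] of the maximum
    equals [lam * C + kap * r] for some [lam] and [kap] that are feasible for
    the dual program.  The dual constraint is stated as an inequality between
    positively homogeneous functions on the orthant. *)
Lemma conic_multipliers (R : realType) (m p : nat) (mu b : 'cV[R]_m)
    (L : 'M[R]_(p, m)) (C r v : R) :
  0 < C ->
  \sum_(j < m) b j 0 = C -> (forall j, 0 <= b j 0) -> norm2 (L *m b) < r ->
  (forall x : 'cV[R]_m, \sum_(j < m) x j 0 = C -> (forall j, 0 <= x j 0) ->
     norm2 (L *m x) <= r -> dotv mu x <= v) ->
  exists lam kap : R, [/\ 0 <= kap, lam * C + kap * r = v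
    & forall x : 'cV[R]_m, (forall j, 0 <= x j 0) ->
        dotv mu x <= lam * (\sum_(j < m) x j 0) + kap * norm2 (L *m x)].
Proof.
move=> C0 bC b0 br opt.
pose D : set 'cV[R]_m :=
  [set x | \sum_(j < m) x j 0 = C /\ forall j, 0 <= x j 0]%classic.
have sumZ a (x : 'cV[R]_m) :
    \sum_(j < m) (a *: x) j 0 = a * \sum_(j < m) x j 0.
  by rewrite mulr_sumr; apply: eq_bigr => j _; rewrite mxE.
have [||x [xC x0] gx|kap kap0 Hkap] := @one_constraint_multiplier R _ D
    (fun x => dotv mu x - v) (fun x => norm2 (L *m x) - r) b _ (conj bC b0).
- move=> x y t [xC x0] [yC y0] /andP[t0 t1].
  have u0 : 0 <= 1 - t by rewrite subr_ge0.
  split.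
  + split=> [|j]; last by rewrite !mxE addr_ge0 ?mulr_ge0.
    under eq_bigr do rewrite mxE.
    by rewrite big_split /= !sumZ xC yC; ring.
  + by rewrite dotvDr !dotvZr le_eqVlt; apply/orP; left; apply/eqP; ring.
  + have := norm2_triangle (t *: (L *m x)) ((1 - t) *: (L *m y)).
    by rewrite mulmxDr -!scalemxAr !norm2Z//; lra.
- by rewrite subr_lt0.
- by rewrite subr_le0 opt// -subr_le0.
(* [lam] is forced by the required value of the dual objective. *)
exists ((v - kap * r) / C), kap; split=> //.
  by rewrite divfK ?subrK ?gt_eqF.
move=> x x0.
have : 0 <= \sum_(j < m) x j 0 by exact: sumr_ge0.
rewrite le_eqVlt => /predU1P[/esym/(sum_col0 x0)->|s0].
  rewrite mulmx0 dotv0 norm20 big1 => [|j _]; last by rewrite mxE.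
  by rewrite !mulr0 addr0.
set s := \sum_j _ in s0 *.
(* The point of total C on the ray through x. *)
have Dy : D ((C / s) *: x).
  split=> [|j]; first by rewrite sumZ divfK// gt_eqF.
  by rewrite mxE mulr_ge0// divr_ge0 ?ltW.
have a0 : 0 < C / s by rewrite divr_gt0.
have := Hkap _ Dy.
rewrite dotvZr -scalemxAr (norm2Z _ (ltW a0)) => H.
rewrite -(ler_pM2l a0).
have -> : C / s * ((v - kap * r) / C * s + kap * norm2 (L *m x)) =
  v + kap * (C / s * norm2 (L *m x) - r) by field; rewrite !gt_eqF.
by rewrite -lerBlDl.
Qed.

Lemma interior_lorentz_cone (R : realType) (m : nat) (y : 'cV[R]_m) (s : R) :
  interior (@lorentz_cone R m) (y, s) -> norm2 y < s.
Proof.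
move=> /nbhs_ballP[e /= e0 he].
have /he : ball (y, s) e (y, s - e / 2).
  split; first exact: ballxx.
  rewrite -ball_normE /ball_ /= opprB addrC subrK.
  by rewrite gtr0_norm ?divr_gt0// ltr_pdivrMr// mulr_natr mulr2n ltrDl.
rewrite /lorentz_cone /= => h; apply: (le_lt_trans h).
by rewrite ltrBlDr ltrDl divr_gt0.
Qed.

(** If the game is dominated by [lam * c(S) + kap * R(S)], with equality at the
    grand coalition, and no coalition has a larger risk threshold per capita
    than the grand coalition, then sharing the risk term equally and the capital
    term in proportion to the capital owned gives a core allocation. *)
Lemma core_of_multipliers (R : realType) (N : finType)
    (c : N -> R) (risk : {set N} -> R) (nu : {set N} -> R) (lam kap : R) :
  0 <= kap ->
  (0 < #|N|)%N ->
  (forall S : {set N}, S != finset.set0 ->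
     risk S / #|S|%:R <= risk [set: N]%SET / #|N|%:R) ->
  lam * coalition_capital c [set: N]%SET + kap * risk [set: N]%SET
    = nu [set: N]%SET ->
  (forall S : {set N}, nu S <= lam * coalition_capital c S + kap * risk S) ->
  (core nu !=set0)%classic.
Proof.
move=> kap0 N0 rS nuN nuS.
set r := risk [set: N]%SET in rS nuN.
have zE (S : {set N}) : \sum_(i in S) (lam * c i + kap * (r / #|N|%:R)) =
    lam * coalition_capital c S + kap * (#|S|%:R * (r / #|N|%:R)).
  rewrite big_split /= -mulr_sumr sumr_const; congr (_ + _).
  by rewrite -(mulr_natl (kap * _)) mulrCA.
exists (fun i => lam * c i + kap * (r / #|N|%:R)); split=> [|S S0].
  have -> : \sum_(i : N) (lam * c i + kap * (r / #|N|%:R)) =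
      \sum_(i in [set: N]%SET) (lam * c i + kap * (r / #|N|%:R)).
    by apply: eq_bigl => i; rewrite finset.in_setT.
  by rewrite zE cardsT [_ * (r / _)]mulrC divfK ?pnatr_eq0 -?lt0n.
rewrite zE; apply: (le_trans (nuS S)); rewrite lerD2l ler_wpM2l//.
have S0' : 0 < #|S|%:R :> R by rewrite ltr0n card_gt0.
by have := rS S S0; rewrite ler_pdivrMr// mulrC.
Qed.

Theorem theorem12 (R : realType) (N : finType) (m : nat)
    (c : N -> R) (mu : 'cV[R]_m) (Q L : 'M[R]_m)
    (risk : {set N} -> R) (nu : {set N} -> R)
    (Q_posdef : posdefmx Q)
    (Q_cholesky : cholesky Q L)
    (risk_ge0 : forall S : {set N}, 0 <= risk S)
    (nu_game : markowitz_game c mu Q risk nu)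
    (risk_per_capita : forall S T : {set N},
       S != finset.set0 -> T != finset.set0 -> (#|S| <= #|T|)%N ->
       risk S / #|S|%:R <= risk T / #|T|%:R)
    (N_slater : slater c L risk [set: N]%SET) :
  (core nu !=set0)%classic.
Proof.
have QE := Q_cholesky.2.
have feasP S x := @conic_feasible_proj R N m c Q L risk S x QE (risk_ge0 S).
have conicE S y s x : conic_feasible c L risk S (y, s, x) ->
    [/\ y = L *m x, s = risk S & norm2 (L *m x) <= risk S].
  case=> _ /eqP; rewrite addrC subr_eq0 => /eqP yE sE + _.
  by rewrite /lorentz_cone /= -yE sE.
have [y [s [b [bf /interior_lorentz_cone yb b_gt0]]]] := N_slater.
have [yE sE _] := conicE _ _ _ _ bf; rewrite yE sE in yb.
have bM : markowitz_feasible c Q risk [set: N]%SET b by apply/feasP; exists y, s.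
have [bC _ b_ge0] := bM.
have [m0|m_gt0] := posnP m.
  (* Without assets, the game is identically zero. *)
  have nu0 S : nu S = 0.
    have [[x _ <-] _] := nu_game S.
    by rewrite /dotv big1// => -[j jm]; exfalso; move: jm; rewrite m0.
  exists (fun=> 0); split=> [|S _]; first by rewrite nu0 big1.
  by rewrite nu0 big1.
(* The Slater point is positive in every one of the m > 0 components. *)
have C_gt0 : 0 < coalition_capital c [set: N]%SET.
  rewrite -bC (bigD1 (Ordinal m_gt0))//= ltr_pwDl ?b_gt0//.
  by apply: sumr_ge0 => j _; exact: ltW.
have N_gt0 : (0 < #|N|)%N.
  rewrite lt0n -cardsT cards_eq0; apply: contraTneq C_gt0 => ->.
  by rewrite /coalition_capital finset.big_set0 ltxx.
have feasI S (x : 'cV[R]_m) : \sum_(j < m) x j 0 = coalition_capital c S ->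
    (forall j, 0 <= x j 0) -> norm2 (L *m x) <= risk S ->
    markowitz_feasible c Q risk S x.
  move=> xC x0 xr; apply/feasP; exists (L *m x), (risk S).
  split=> //; last exact: addNr.
  by rewrite -xC; apply: eq_bigr => j _; rewrite mxE mul1r.
have [|lam [kap [kap0 nuN dual]]] :=
    conic_multipliers (mu := mu) (v := nu [set: N]%SET) C_gt0 bC b_ge0 yb.
  move=> x xC x0 xr; apply: (nu_game [set: N]%SET).2.
  by exists x => //; exact: feasI.
apply: (core_of_multipliers kap0 N_gt0 _ nuN) => [S S0|S].
  rewrite -cardsT; apply: risk_per_capita => //; last by rewrite cardsT max_card.
  by rewrite -card_gt0 cardsT.
have [[x xf <-] _] := nu_game S.
have [xC _ x0] := xf.
have /feasP[y' [s' xc]] := xf.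
have [_ _ xr] := conicE _ _ _ _ xc.
by rewrite -xC (le_trans (dual x x0))// lerD2l ler_wpM2l.
Qed.
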